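(* Let $S$ be a finite non-abelian simple group and let $R\le\mathrm{Hol}(S)$ be a solvable regular subgroup. For every prime $p\in\pi(R/R')$ there exists an infinite sequence of finite simple skew braces $B_0,B_1,B_2,\ldots$ such that $(B_m,+)\cong S^{p^m}$ for every $m\ge0$, while every $(B_m,\circ)$ is solvable. Moreover, the braces may be chosen to form a nested tower under diagonal subbrace embeddings, i.e. so that $B_m$ embeds diagonally as a subbrace of $B_{m+1}$ for every $m\ge 0$.
   Context: A skew brace is a triple $(B,+,\circ)$ such that $(B,+)$ and $(B,\circ)$ are groups (neither assumed abelian) on the same set and $a\circ(b+c)=a\circ b-a+a\circ c$ for all $a,b,c\in B$. The two identity elements coincide and are denoted $0$. Its lambda map is $\lambda^B:(B,\circ)\to\mathrm{Aut}(B,+)$, $\lambda^B_a(b)=-a+a\circ b$. An ideal is a subgroup $I\le(B,+)$ with $I\trianglelefteq(B,+)$, $I\trianglelefteq(B,\circ)$ and $\lambda^B_a(I)=I$ for all $a\in B$. A non-zero skew brace is simple if its only ideals are $0$ and $B$. A subbrace is a subset that is a subgroup of both $(B,+)$ and $(B,\circ)$. For a group $H$, $\mathrm{Hol}(H)=H\rtimes\mathrm{Aut}(H)$ acts on $H$ by $(x,f)\cdot h=x\,f(h)$; a subgroup of $\mathrm{Hol}(H)$ is regular if its action on $H$ is transitive and free. $R'$ is the commutator subgroup of $R$, and $\pi(H)$ denotes the set of prime divisors of $|H|$ for a finite group $H$. ''$B_m$ embeds diagonally as a subbrace of $B_{m+1}$'' means that there is a group isomorphism $\psi:(B_{m+1},+)\to(B_m,+)^p$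 such that $B_m\to B_{m+1}$, $a\mapsto\psi^{-1}(a,\dots,a)$, is an injective homomorphism of skew braces (respecting both $+$ and $\circ$). *)

(* Defs.v *)
From HB Require Import structures.
From mathcomp Require Import all_boot all_fingroup all_solvable.

Set Implicit Arguments.
Unset Strict Implicit.
Unset Printing Implicit Defensive.

Import GroupScope.

(* The additive group (B, +) of a skew brace is the ambient group structure of
   B, hence written multiplicatively: b + c is b * c, - a is a^-1, 0 is 1.
   Its second group law is [circ], with its own unit and inverse. *)
HB.mixin Record isSkewBrace B of monoid.Group B := {
  circ : B -> B -> B;
  circ_one : B;
  circ_inv : B -> B;
  circA : associative circ;
  circ1b : left_id circ_one circ;
  circb1 : right_id circ_one circ;
  circVb : left_inverse circ_one circ_inv circ;
  circbV : right_inverse circ_one circ_inv circ;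
  circ_brace : forall a b c : B,
    circ a (b * c) = circ a b * a^-1 * circ a c
}.

#[short(type="skewBraceType")]
HB.structure Definition SkewBrace := { B of isSkewBrace B & monoid.Group B }.

#[short(type="finSkewBraceType")]
HB.structure Definition FinSkewBrace :=
  { B of isSkewBrace B & monoid.Group B & Finite B }.

Lemma circ_oneE (B : skewBraceType) : circ_one = 1 :> B.
Proof.
have := circ_brace (circ_one : B) 1 1.
rewrite !circ1b !mul1g mulg1 => /(congr1 (fun x : B => x^-1)).
by rewrite invg1 invgK => <-.
Qed.

(* The carrier of B equipped with the group (B, circ). *)
Definition circ_group (B : Type) : Type := B.

HB.instance Definition _ (B : skewBraceType) := Choice.on (circ_group B).
HB.instance Definition _ (B : skewBraceType) :=
  isGroup.Build (circ_group B)
    (@circA B) (@circ1b B) (@circb1 B) (@circVb B) (@circbV B).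
HB.instance Definition _ (B : finSkewBraceType) := Finite.on (circ_group B).

Definition lambda (B : skewBraceType) (a b : B) : B := a^-1 * circ a b.

(* [<|] does not entail that its left-hand side is a subgroup, hence the two
   [group_set] conditions. *)
Definition is_ideal (B : finSkewBraceType) (I : {set B}) : Prop :=
  let Ic : {set circ_group B} := I in
  [/\ group_set I, I <| [set: B], group_set Ic, Ic <| [set: circ_group B]
    & forall a : B, lambda a @: I = I].

Definition simple_brace (B : finSkewBraceType) : Prop :=
  [set: B] != 1 /\
  forall I : {set B}, is_ideal I -> I = 1 \/ I = [set: B].

Definition brace_morphism (B C : skewBraceType) (f : B -> C) : Prop :=
  {morph f : a b / a * b} /\ {morph f : a b / circ a b}.

(* The direct power (G, +)^n, with its componentwise group structure. *)
Notation dirpow G n := {dffun forall _ : 'I_n, G}.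

Definition diagonally_embeds (p : nat) (B C : finSkewBraceType) : Prop :=
  exists (psi : C -> dirpow B p) (psi' : dirpow B p -> C),
    [/\ cancel psi psi', cancel psi' psi,
        {morph psi : x y / x * y},
        injective (fun a : B => psi' [ffun=> a])
      & brace_morphism (fun a : B => psi' [ffun=> a])].

(* Hol(H), the semidirect product for the left action of Aut(H) on H.  The
   product of permutations is left-to-right, i.e., (g * f) h = f (g h), so that
   the composite f \o g in (x, f)(y, g) = (x f(y), f \o g) is g * f. *)
Section Holomorph.

Variable H : finGroupType.

Record holomorph := Hol {
  hol_val :> H * {perm H};
  hol_valP : hol_val.2 \in Aut [set: H]
}.

HB.instance Definition _ := [isSub for hol_val].
HB.instance Definition _ := [Finite of holomorph by <:].

Definition hol_one : holomorph := @Hol (1, 1) (group1 _).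
Definition hol_mul (u v : holomorph) : holomorph :=
  @Hol (u.1 * u.2 v.1, v.2 * u.2) (groupM (hol_valP v) (hol_valP u)).
Definition hol_inv (u : holomorph) : holomorph :=
  @Hol (u.2^-1 u.1^-1, u.2^-1) (groupVr (hol_valP u)).

Lemma hol_autM (u : holomorph) : {morph u.2 : x y / x * y}.
Proof. by move=> x y; apply: (morphicP (Aut_morphic (hol_valP u))); rewrite inE. Qed.

Lemma hol_mulA : associative hol_mul.
Proof.
move=> u v w; apply: val_inj => /=; congr (_, _).
  by rewrite hol_autM permM mulgA.
by rewrite mulgA.
Qed.

Lemma hol_mul1 : left_id hol_one hol_mul.
Proof.
by move=> u; apply: val_inj; rewrite /= perm1 mul1g mulg1; case: (hol_val u).
Qed.

Lemma hol_mulV : left_inverse hol_one hol_inv hol_mul.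
Proof.
move=> u; apply: val_inj; rewrite /= mulgV; congr (_, _).
apply: (@perm_inj _ u.2); rewrite hol_autM !permKV mulVg.
by apply: (mulgI (u.2 1)); rewrite -hol_autM !mulg1.
Qed.

HB.instance Definition _ :=
  Finite_isGroup.Build holomorph hol_mulA hol_mul1 hol_mulV.

Definition hol_act (u : holomorph) (h : H) : H := u.1 * u.2 h.

Lemma hol_act1 h : hol_act 1 h = h.
Proof. by rewrite /hol_act /= perm1 mul1g. Qed.

Lemma hol_actM u v h : hol_act (u * v) h = hol_act u (hol_act v h).
Proof. by rewrite /hol_act /= hol_autM permM mulgA. Qed.

Definition regular (R : {set holomorph}) : Prop :=
  (forall h k : H, exists2 u, u \in R & hol_act u h = k) /\
  (forall (h : H) (u : holomorph), u \in R -> hol_act u h = h -> u = 1).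

End Holomorph.

(* Main.v *)
(* Let B be a finite skew brace with a surjective character chi of (B, o) onto
   Z/p.  On (B, +)^p, let f a be the sum of the chi (a_i) and put
     (a o b)_i = a_i o b_(i - f a),
   i.e., twist the direct power by the cyclic shift of the coordinates.  As f
   is shift-invariant, this is again a skew brace and f is a surjective
   character of its circle group, so that the construction iterates.  The
   kernel of f is a subgroup of (B, o)^p, whence solvability.

   Simplicity is propagated in the stronger form lambda_simple (only normality
   in (B, +) and lambda-invariance are used), jointly with Z(B, +) = 1.  A
   non-zero I in the twist contains, by commutation with one coordinate, a
   non-zero element supported on a single coordinate i; the elements a with
   f a = 0 act there through all of lambda(B), so I contains the whole i-th
   factor, and the elements with f a <> 0 move it to the other factors.

   The tower starts with the brace on S defined by R, whose circle group is R;
   chi comes from the quotient of order p of R / R'. *)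

From HB Require Import structures.
Require Import Defs.
From mathcomp Require Import all_boot all_fingroup all_solvable.
From mathcomp Require Import ssralg zmodp.

Set Implicit Arguments.
Unset Strict Implicit.
Unset Printing Implicit Defensive.

Import GroupScope GRing.Theory.

(** * Characters of a finite group onto Z/p *)

Lemma abelian_index_prime (gT : finGroupType) (A : {group gT}) p :
  abelian A -> p \in \pi(A) ->
  exists2 H : {group gT}, H \subset A & #|A : H| = p.
Proof.
move=> abA; rewrite mem_primes => /and3P[p_pr _ p_dvd].
have [P sylP] := Sylow_exists p A.
have [Q hallQ] := Hall_exists p^' (abelian_sol abA).
have pP := pHall_pgroup sylP; have p'Q := pHall_pgroup hallQ.
have cardP : #|P| = (p ^ logn p #|A|)%N by rewrite (card_Hall sylP) p_part.
have lt0 : 0 < logn p #|A| by rewrite logn_gt0 mem_primes p_pr cardG_gt0.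
(* [P1] has index [p] in the Sylow subgroup [P]; the exponent [.-1] is genuine by [lt0]. Its product
   with the Hall complement [Q] is the desired subgroup. *)
have [|P1 [sP1P _ cardP1]] :=
  normal_pgroup (r := (logn p #|A|).-1) pP (normal_refl P).
  by rewrite cardP pfactorK // leq_pred.
have sPA := pHall_sub sylP; have sQA := pHall_sub hallQ.
have sP1A := subset_trans sP1P sPA.
have cQP1 : Q \subset 'C(P1) := sub_abelian_cent2 abA sQA sP1A.
have cardQP1 : #|Q <*> P1| = (#|Q| * #|P1|)%N.
  rewrite cent_joinEl // coprime_cardMg // coprime_sym.
  exact: pnat_coprime (pgroupS sP1P pP) p'Q.
exists (Q <*> P1)%G; first by rewrite join_subG sQA.
apply/eqP; rewrite -(eqn_pmul2l (cardG_gt0 (Q <*> P1)%G)) Lagrange; last first.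
  by rewrite join_subG sQA.
rewrite /= cardQP1 cardP1 -mulnA -expnSr prednK // -p_part mulnC.
by rewrite (card_Hall hallQ) partnC.
Qed.

Lemma abelianization_onto_Zp (gT : finGroupType) (G : {group gT}) n :
    n.+2 \in \pi(G / G^`(1)) ->
  exists f : gT -> 'I_n.+2,
    {in G &, {morph f : x y / x * y >-> (x + y)%R}} /\
    forall k, exists2 x, x \in G & f x = k.
Proof.
set p := n.+2 => p_pi.
have p_pr : prime p by move: p_pi; rewrite mem_primes; case/andP.
have [H sHA iH] := abelian_index_prime (der_abelian 0 G) p_pi.
have abA := der_abelian 0 G.
have nHA : G / G^`(1) \subset 'N(H) := sub_abelian_norm abA sHA.
set A := (G / G^`(1))%G in sHA iH abA nHA *.
have cardAH : #|A / H| = p by rewrite card_quotient.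
have /isogP[g injg img] : A / H \isog [set: 'I_p].
  by rewrite isog_cyclic_card ?prime_cyclic ?cardsT ?card_ord ?cardAH //=.
exists (fun x => g (coset H (coset G^`(1) x))); split=> [x y Gx Gy | k] /=.
  have nGx z : z \in G -> z \in 'N(G^`(1)) by apply/subsetP; exact: der_norm.
  have Ax z : z \in G -> coset G^`(1) z \in A by move=> Gz; apply: mem_quotient.
  rewrite morphM ?nGx // morphM ?(subsetP nHA) ?Ax //.
  by rewrite morphM ?mem_quotient ?Ax.
have : k \in g @* (A / H) by rewrite img inE.
case/morphimP=> _ _ /morphimP[_ _ /morphimP[x _ Gx ->] ->] ->.
by exists x.
Qed.

(** * The cyclic twist of a direct power *)

Record charBrace (n : nat) := CharBrace {
  char_brace :> finSkewBraceType;
  chi : char_brace -> 'I_n.+1;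
  chiM : {morph chi : a b / circ a b >-> (a + b)%R}
}.
Arguments chi {n} c.

Section Twist.

Variables (n : nat) (X : charBrace n).

Definition twist : Type := dirpow X n.+1.

HB.instance Definition _ := FinGroup.on twist.

Local Open Scope ring_scope.

Implicit Types a b c : twist.

Lemma chi1 : chi X 1%g = 0.
Proof. by apply: (addrI (chi X 1%g)); rewrite -chiM -circ_oneE circ1b addr0. Qed.

Lemma chiV (x : X) : chi X (circ_inv x) = - chi X x.
Proof.
by apply: (addrI (chi X x)); rewrite -chiM circbV subrr circ_oneE chi1.
Qed.

Definition twist_chi (a : twist) : 'I_n.+1 := \sum_i chi X (a i).

Definition twist_circ a b : twist :=
  [ffun i : 'I_n.+1 => circ (a i) (b (i - twist_chi a))].
Definition twist_one : twist := [ffun=> circ_one].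
(** The shift is opposite to that of [twist_circ], because the inverse of [a] has character
    [- twist_chi a]. *)
Definition twist_inv a : twist := [ffun i : 'I_n.+1 => circ_inv (a (i + twist_chi a))].

Lemma twist_chiM : {morph twist_chi : a b / twist_circ a b >-> a + b}.
Proof.
move=> a b; rewrite {3}/twist_chi (reindex_inj (addIr (- twist_chi a))) /=.
by rewrite -big_split; apply: eq_bigr => i _; rewrite ffunE chiM.
Qed.

Lemma twist_chi1 : twist_chi twist_one = 0.
Proof. by apply: big1 => i _; rewrite ffunE circ_oneE chi1. Qed.

Lemma twist_chiV a : twist_chi (twist_inv a) = - twist_chi a.
Proof.
rewrite {2}/twist_chi (reindex_inj (addIr (twist_chi a))) /= -sumrN.
by apply: eq_bigr => i _; rewrite ffunE chiV.
Qed.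

Lemma twist_circA : associative twist_circ.
Proof.
by move=> a b c; apply/ffunP=> i; rewrite !ffunE twist_chiM circA opprD addrA.
Qed.

Lemma twist_circ1 : left_id twist_one twist_circ.
Proof.
by move=> a; apply/ffunP=> i; rewrite !ffunE twist_chi1 subr0 circ1b.
Qed.

Lemma twist_1circ : right_id twist_one twist_circ.
Proof. by move=> a; apply/ffunP=> i; rewrite !ffunE circb1. Qed.

Lemma twist_circV : left_inverse twist_one twist_inv twist_circ.
Proof.
by move=> a; apply/ffunP=> i; rewrite !ffunE twist_chiV opprK circVb.
Qed.

Lemma twist_Vcirc : right_inverse twist_one twist_inv twist_circ.
Proof. by move=> a; apply/ffunP=> i; rewrite !ffunE subrK circbV. Qed.

(** All three circle products have left factor [a], hence the same shift, so the identity reduces to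
    that of [X] in each coordinate. *)
Lemma twist_brace a b c :
  twist_circ a (b * c)%g = (twist_circ a b * a^-1 * twist_circ a c)%g.
Proof. by apply/ffunP=> i; rewrite !ffunE circ_brace. Qed.

HB.instance Definition _ := isSkewBrace.Build twist
  twist_circA twist_circ1 twist_1circ twist_circV twist_Vcirc twist_brace.

Definition twist_char : charBrace n := @CharBrace n twist twist_chi twist_chiM.

End Twist.

(** * Simplicity and solvability of the twist *)

Definition lambda_simple (B : finSkewBraceType) : Prop :=
  forall I : {group B}, I <| [set: B] ->
  (forall a b, b \in I -> lambda a b \in I) -> I :=: 1 \/ I :=: [set: B].

Lemma lambda_simple_simple (B : finSkewBraceType) :
  [set: B] != 1 -> lambda_simple B -> simple_brace B.
Proof.
move=> ntB simB; split=> // I [gI nI _ _ lamI].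
by apply: (simB (Group gI)) => //= a b Ib; rewrite -(lamI a) imset_f.
Qed.

Lemma centerless_commg (gT : finGroupType) (x : gT) :
  'Z([set: gT]) = 1 -> x != 1 -> exists y, [~ x, y] != 1.
Proof.
move=> Z1 ntx; apply/existsP; apply: contraNT ntx => /existsPn noy.
rewrite -in_set1 -[[set 1]]Z1 inE in_setT; apply/centP=> y _.
by apply/commgP; have := noy y; rewrite negbK.
Qed.

(** Provides explicit preimages under [lambda a], which is therefore onto. *)
Lemma lambdaK (B : skewBraceType) (a : B) :
  cancel (fun y => circ (circ_inv a) (a * y)) (lambda a).
Proof. by move=> y; rewrite /lambda circA circbV circ1b mulKg. Qed.

Lemma lambda1 (B : skewBraceType) (a : B) : lambda a 1 = 1.
Proof. by rewrite /lambda -circ_oneE circb1 circ_oneE mulVg. Qed.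

Section TwistProperties.

Variables (n : nat) (X : charBrace n.+1).
Hypothesis chi_onto : forall k, exists x, chi X x = k.

Implicit Types (a b t : twist X) (x y : X).

Definition single (i : 'I_n.+2) (x : X) : twist X :=
  [ffun j => if j == i then x else 1].

Lemma singleE i x j : single i x j = if j == i then x else 1.
Proof. by rewrite ffunE. Qed.

Lemma twist_mulE a b i : (a * b) i = a i * b i.
Proof. by rewrite ffunE. Qed.

Lemma twist_oneE i : (1 : twist X) i = 1.
Proof. by rewrite ffunE. Qed.

Lemma twist_invE a i : a^-1 i = (a i)^-1.
Proof. by rewrite ffunE. Qed.

Lemma twist_circE a b i : circ a b i = circ (a i) (b (i - twist_chi a)%R).
Proof. by rewrite ffunE. Qed.

Lemma singleM i : {morph single i : x y / x * y}.
Proof.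
move=> x y; apply/ffunP=> j; rewrite twist_mulE !singleE.
by case: eqP; rewrite ?mulg1.
Qed.

Lemma single1 i : single i 1 = 1.
Proof. by apply/ffunP=> j; rewrite twist_oneE singleE if_same. Qed.

Lemma single_conj i x a : single i x ^ a = single i (x ^ a i).
Proof.
apply/ffunP=> j; rewrite /conjg !twist_mulE twist_invE !singleE.
by case: eqP => [->|_] //; rewrite mul1g mulVg.
Qed.

Lemma twist_prod_single t : t = \prod_i single i (t i).
Proof.
apply/ffunP=> j.
have evM : {morph (fun a : twist X => a j) : a b / a * b >-> a * b}.
  by move=> a b; rewrite twist_mulE.
rewrite (big_morph (fun a : twist X => a j) evM (twist_oneE j)).
under eq_bigr do rewrite singleE.
by rewrite -big_mkcond /= (big_pred1 j) // => i; rewrite eq_sym.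
Qed.

(** The lambda action permutes the factors by the shift [twist_chi a], acting on the way through
    [lambda] of [X]; in the other coordinates [a^-1] cancels [a] by [lambda1]. *)
Lemma lambda_single a i x (j := (i + twist_chi a)%R) :
  lambda a (single i x) = single j (lambda (a j) x).
Proof.
apply/ffunP=> k; rewrite /lambda twist_mulE twist_invE twist_circE !singleE.
rewrite /j -(inj_eq (addIr (twist_chi a))) subrK.
by case: eqP => [->|_] //; exact: lambda1.
Qed.

Lemma twist_chi_single i x : twist_chi (single i x) = chi X x.
Proof.
rewrite /twist_chi (bigD1 i) //= singleE eqxx big1 ?addr0 // => j /negPf ji.
by rewrite singleE ji chi1.
Qed.

Lemma twist_chi_onto k : exists a, twist_chi a = k.
Proof.
by have [x <-] := chi_onto k; exists (single 0%R x); exact: twist_chi_single.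
Qed.

(** Commuting with every [single i x] forces the [i]-th coordinate to be central in [X]. *)
Lemma twist_center : 'Z([set: X]) = 1 -> 'Z([set: twist X]) = 1.
Proof.
move=> Z1; apply/trivgP/subsetP=> a /centerP[_ Za]; apply/set1P/ffunP=> i.
rewrite twist_oneE; apply/set1P; rewrite -[[set 1]]Z1; apply/centerP.
split=> [|x _]; first by rewrite inE.
have := Za (single i x) (in_setT _) => /(congr1 (fun t : twist X => t i)).
by rewrite !twist_mulE singleE eqxx.
Qed.

Lemma twist_lambda_simple :
  'Z([set: X]) = 1 -> lambda_simple X -> lambda_simple (twist X).
Proof.
move=> Z1 simX I nI lamI.
have [|ntI] := eqVneq (I : {set _}) 1; [by left | right].
have /subsetPn[t It /set1P nt1] : ~~ (I \subset [1]).
  by apply: contra ntI => /trivgP->.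
have /existsP[i nti] : [exists i, t i != 1].
  apply: contraT => /existsPn t1; case: nt1; apply/ffunP=> i; rewrite twist_oneE.
  by apply/eqP; have := t1 i; rewrite negbK.
have nIx a s : s \in I -> s ^ a \in I.
  by move=> Is; rewrite memJ_norm // (subsetP (normal_norm nI)) ?inE.
have [y nty] := centerless_commg Z1 nti.
(* The trace of [I] on the [i]-th factor: shown to be normal and lambda-invariant in [X], it is
   trivial or everything. *)
pose J := [set x : X | single i x \in I].
have gJ : group_set J.
  apply/group_setP; split=> [|u v]; rewrite !inE ?single1 ?group1 // singleM.
  exact: groupM.
have nJ : Group gJ <| [set: X].
  rewrite /normal subsetT; apply/normsP=> u _; apply/setP=> v.
  rewrite mem_conjg !inE.
  have cnj w z : single i z \in I -> single i (z ^ w) \in I.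
    by move/(nIx (single i w)); rewrite single_conj singleE eqxx.
  by apply/idP/idP=> [/(cnj u)|/(cnj u^-1)] //; rewrite conjgKV.
have lamJ u v : v \in Group gJ -> lambda u v \in Group gJ.
  rewrite !inE => Iv; pose j := (i + 1)%R.
  have ji : (i == j) = false by rewrite -subr_eq0 opprD addNKr oppr_eq0 oner_eq0.
  have [w chiw] := chi_onto (- chi X u)%R.
  (* The second factor brings twist_chi a to 0 without affecting the i-th
     coordinate; this is where a second coordinate is needed. *)
  pose a : twist X := circ (single i u) (single (j - chi X u)%R w).
  have chia : twist_chi a = 0%R by rewrite twist_chiM !twist_chi_single chiw subrr.
  have := lamI a _ Iv; rewrite lambda_single chia addr0 twist_circE !singleE eqxx.
  rewrite twist_chi_single (inj_eq (addIr _)) ji -circ_oneE circb1.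
  exact: id.
have {simX} JT x : single i x \in I.
  have: x \in Group gJ; last by rewrite inE.
  case: (simX _ nJ lamJ) => [J1|->]; last by rewrite inE.
  (* A trivial trace is excluded by the commutator of [t] with [single i y]: it lies in [I] and
     equals [single i [~ t i, y]], which is not 1. *)
  case/eqP: nty; apply/set1P; rewrite -[[set 1]]J1 inE.
  have := groupM (groupVr It) (nIx (single i y) _ It).
  suff -> : t^-1 * t ^ single i y = single i [~ t i, y] by [].
  apply/ffunP=> k; rewrite /conjg !twist_mulE !twist_invE !singleE.
  by case: eqP => [->|_]; rewrite ?commgEl // invg1 mul1g mulg1 mulVg.
(* Any [s] is a product of its coordinates. An [a] of character [j - i] carries the [i]-th factor to
   the [j]-th, and the preimage from [lambdaK] makes the result equal to [single j (s j)]. *)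
apply/setP=> s; rewrite inE (twist_prod_single s) group_prod // => j _.
have [a chia] := twist_chi_onto (j - i)%R.
have := lamI a _ (JT (circ (circ_inv (a j)) (a j * s j))).
by rewrite lambda_single chia addrC subrK lambdaK.
Qed.

Lemma twist_solvable :
  solvable [set: circ_group X] -> solvable [set: circ_group (twist X)].
Proof.
case/derivedP=> d derX.
pose f (a : circ_group (twist X)) : 'I_n.+2 := twist_chi a.
have fM : {in [set: circ_group (twist X)] &, {morph f : a b / a * b}}.
  by move=> a b _ _; exact: twist_chiM.
pose fm := Morphism fM; pose K := 'ker fm.
(* The quotient by [K] embeds in the abelian group Z/p. *)
have derK : [set: circ_group (twist X)]^`(1) \subset K.
  apply: der1_min (ker_norm _) _.
  rewrite (isog_abelian (first_isog fm)).
  apply: sub_abelian_cent2 (subsetT _) (subsetT _).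
  by apply/centsP=> u _ v _; exact: addrC.
have solK : solvable K.
  apply/derivedP; exists d; apply/trivgP/subsetP=> a Ka; apply/set1P/ffunP=> i.
  pose ev (b : circ_group (twist X)) : circ_group X := b i.
  (* On [K] the shift vanishes, so each coordinate is a morphism to the circle group of [X]; the
     [d]-th derived subgroup of [K] then dies in every coordinate. *)
  have evM : {in K &, {morph ev : b c / b * c}}.
    move=> b c /mker fb _; rewrite /ev; have := twist_circE b c i.
    by rewrite [twist_chi b]fb subr0.
  pose e := Morphism evM.
  have : e a \in e @* K^`(d) by rewrite mem_morphim // (subsetP (der_sub d K)).
  rewrite morphim_der // => /(subsetP (dergS d (subsetT _))).
  by rewrite derX => /set1P; rewrite /= /ev => ->; rewrite ffunE.
have nK := der_normal 1 [set: circ_group (twist X)].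
by rewrite (series_sol nK) (solvableS derK solK) abelian_sol ?der_abelian.
Qed.

End TwistProperties.

(** * The base of the tower: the brace of a regular subgroup *)

Lemma lambda_simple_of_simple (B : finSkewBraceType) :
  simple [set: B] -> lambda_simple B.
Proof. by case/simpleP=> _ simB I nI _; exact: simB. Qed.

Lemma simple_centerless (gT : finGroupType) :
  simple [set: gT] -> ~~ abelian [set: gT] -> 'Z([set: gT]) = 1.
Proof.
case/simpleP=> _ simG; apply: contraNeq => ntZ.
case: (simG _ (center_normal [set: gT])) => [Z1|<-]; last exact: center_abelian.
by rewrite Z1 eqxx in ntZ.
Qed.

Section RegularBrace.

Variables (H : finGroupType) (R : {group holomorph H}) (regR : regular R).

Lemma regular_rep_ex (a : H) : exists u, (u \in R) && (hol_act u 1 == a).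
Proof.
by case: regR => /(_ 1 a)[u Ru ua] _; exists u; rewrite Ru ua eqxx.
Qed.

Definition regular_rep a : holomorph H := xchoose (regular_rep_ex a).

Lemma regular_rep_in a : regular_rep a \in R.
Proof. by case/andP: (xchooseP (regular_rep_ex a)). Qed.

Lemma regular_repK : cancel regular_rep (fun u => hol_act u 1).
Proof. by move=> a; case/andP: (xchooseP (regular_rep_ex a)) => _ /eqP. Qed.

(** Freeness at 1 determines an element of [R] by its image of 1. Together with [regular_repK] this
    identifies [R] with [H]. *)
Lemma hol_act1K u : u \in R -> regular_rep (hol_act u 1) = u.
Proof.
move=> Ru; set v := regular_rep _; have Rv : v \in R by apply: regular_rep_in.
apply/esym/eqP; rewrite eq_mulVg1; apply/eqP; apply: (proj2 regR 1).
  by rewrite groupM ?groupV.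
by rewrite hol_actM regular_repK -hol_actM mulVg hol_act1.
Qed.

(** A copy of [H] whose type records the regularity proof, so that the brace structure attached to
    it can depend on [R]. *)
Definition regular_brace of regular R : Type := H.

HB.instance Definition _ := FinGroup.on (regular_brace regR).

Definition regular_circ (a b : H) : H := hol_act (regular_rep a) b.
Definition regular_inv (a : H) : H := hol_act (regular_rep a)^-1 1.

(** Both sides lie in [R] and send 1 to the same point. The circle group is thus [R] transported
    along the orbit map of 1. *)
Lemma regular_repM :
  {morph regular_rep : a b / regular_circ a b >-> a * b}.
Proof.
move=> a b; rewrite -[RHS]hol_act1K ?groupM ?regular_rep_in //.
by rewrite hol_actM regular_repK.
Qed.

Lemma regular_rep1 : regular_rep 1 = 1.
Proof. by rewrite -[1 in LHS]hol_act1 hol_act1K. Qed.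

Lemma regular_repV a : regular_rep (regular_inv a) = (regular_rep a)^-1.
Proof. by rewrite hol_act1K // groupV regular_rep_in. Qed.

Lemma regular_circA : associative regular_circ.
Proof. by move=> a b c; rewrite /regular_circ regular_repM hol_actM. Qed.

Lemma regular_circ1 : left_id 1 regular_circ.
Proof. by move=> a; rewrite /regular_circ regular_rep1 hol_act1. Qed.

Lemma regular_1circ : right_id 1 regular_circ.
Proof. by move=> a; exact: regular_repK. Qed.

Lemma regular_circV : left_inverse 1 regular_inv regular_circ.
Proof.
move=> a; rewrite /regular_circ regular_repV -{2}[a]regular_repK.
by rewrite -hol_actM mulVg hol_act1.
Qed.

Lemma regular_Vcirc : right_inverse 1 regular_inv regular_circ.
Proof.
by move=> a; rewrite /regular_circ /regular_inv -hol_actM mulgV hol_act1.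
Qed.

(** The automorphism part [u.2] fixes 1, so [u.1] is [a] and [regular_circ a b] is [a * u.2 b]; the
    brace identity is then the multiplicativity of [u.2]. *)
Lemma regular_circ_brace a b c :
  regular_circ a (b * c) = regular_circ a b * a^-1 * regular_circ a c.
Proof.
rewrite -{3}[a]regular_repK /regular_circ; set u := regular_rep a.
have u1 : u.2 1 = 1 by apply: (mulgI (u.2 1)); rewrite -hol_autM !mulg1.
by rewrite /hol_act u1 hol_autM mulg1 !mulgA mulgKV.
Qed.

HB.instance Definition _ := isSkewBrace.Build (regular_brace regR)
  regular_circA regular_circ1 regular_1circ regular_circV regular_Vcirc
  regular_circ_brace.

Lemma regular_brace_isog : [set: H] \isog [set: regular_brace regR].
Proof.
pose f (a : H) : regular_brace regR := a.
have fM : {in [set: H] &, {morph f : a b / a * b}} by [].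
apply/isogP; exists (Morphism fM); first by apply/injmP=> a b _ _.
by apply/setP=> a; rewrite inE; apply/imsetP; exists a; rewrite ?inE.
Qed.

Lemma regular_brace_solvable :
  solvable R -> solvable [set: circ_group (regular_brace regR)].
Proof.
pose f (a : circ_group (regular_brace regR)) := regular_rep a.
have fM : {in [set: circ_group (regular_brace regR)] &, {morph f : a b / a * b}}.
  by move=> a b _ _; exact: regular_repM.
have injf : 'injm (Morphism fM).
  by apply/injmP=> a b _ _; exact: can_inj regular_repK a b.
rewrite -(injm_sol injf) //; apply: solvableS.
by apply/subsetP=> _ /morphimP[a _ _ ->]; exact: regular_rep_in.
Qed.

End RegularBrace.

(** * Iterated direct powers of [S] *)

Section Powers.

Variable S : finGroupType.

(** The index type is left free so that a power of a power is indexed by a product type; enumeration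
    by ['I_k] occurs only once, in [is_power_isog]. *)
Definition is_power (k : nat) (G : finGroupType) : Prop :=
  exists (J : finType) (f : G -> {dffun forall _ : J, S}),
    [/\ #|J| = k, bijective f & {morph f : x y / x * y}].

Lemma is_power1 (G : finGroupType) (f : G -> S) :
  bijective f -> {morph f : x y / x * y} -> is_power 1 G.
Proof.
case=> g fK gK fM; exists unit, (fun x => [ffun=> f x]).
split; first exact: card_unit.
  exists (fun u : {dffun forall _ : unit, S} => g (u tt)) => [x|u].
    by rewrite ffunE.
  by apply/ffunP=> -[]; rewrite ffunE.
by move=> x y; apply/ffunP=> j; rewrite !ffunE fM.
Qed.

Lemma is_power_dirpow k n (G : finGroupType) :
  is_power k G -> is_power (n * k) (dirpow G n).
Proof.
case=> J [f [<- [g fK gK] fM]].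
exists ('I_n * J)%type, (fun t : dirpow G n => [ffun ij => f (t ij.1) ij.2]).
split; first by rewrite card_prod card_ord.
  exists (fun u : {dffun forall _ : 'I_n * J, S} =>
      [ffun i => g [ffun j => u (i, j)]]).
    move=> t; apply/ffunP=> i; rewrite ffunE -[RHS]fK; congr g.
    by apply/ffunP=> j; rewrite !ffunE.
  by move=> u; apply/ffunP=> -[i j]; rewrite !ffunE gK ffunE.
by move=> t u; apply/ffunP=> ij; rewrite !ffunE fM ffunE.
Qed.

Lemma is_power_isog k (G : finGroupType) :
  is_power k G -> [set: G] \isog [set: dirpow S k].
Proof.
case=> J [f [<- [g fK gK] fM]].
pose h (x : G) : dirpow S #|J| := [ffun i => f x (enum_val i)].
have hM : {in [set: G] &, {morph h : x y / x * y}}.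
  by move=> x y _ _; apply/ffunP=> i; rewrite !ffunE fM ffunE.
apply/isogP; exists (Morphism hM).
  apply/injmP=> x y _ _ /ffunP hxy; apply: (can_inj fK); apply/ffunP=> j.
  by have := hxy (enum_rank j); rewrite !ffunE enum_rankK.
apply/setP=> t; rewrite inE; apply/imsetP.
exists (g [ffun j => t (enum_rank j)]); first by rewrite !inE.
by apply/ffunP=> i; rewrite ffunE gK ffunE enum_valK.
Qed.

End Powers.

Theorem corollaryD (S : finGroupType)
    (simpleS : simple [set: S]) (nonabelianS : ~~ abelian [set: S])
    (R : {group holomorph S}) (solvableR : solvable R) (regularR : regular R)
    (p : nat) (p_pi : p \in \pi(R / R^`(1))) :
  exists B : nat -> finSkewBraceType,
    (forall m : nat,
       [/\ simple_brace (B m),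
           [set: B m] \isog [set: dirpow S (p ^ m)%N]
         & solvable [set: circ_group (B m)]]) /\
    (forall m : nat, diagonally_embeds p (B m) (B m.+1)).
Proof.
case: p p_pi => [|[|n]] p_pi; try by move: p_pi; rewrite mem_primes.
have [f [fM f_onto]] := abelianization_onto_Zp p_pi.
pose chi0 (a : regular_brace regularR) : 'I_n.+2 := f (regular_rep regularR a).
have chi0M : {morph chi0 : a b / circ a b >-> (a + b)%R}.
  by move=> a b; rewrite /chi0 regular_repM fM ?regular_rep_in.
pose X m : charBrace n.+1 := iter m (@twist_char n.+1) (CharBrace chi0M).
have isoS := regular_brace_isog regularR.
have simS0 : simple [set: regular_brace regularR] by rewrite -(isog_simple isoS).
have nonabS0 : ~~ abelian [set: regular_brace regularR].
  by rewrite -(isog_abelian isoS).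
have chi_onto m k : exists x, chi (X m) x = k.
  elim: m k => [|m IHm] k; last exact: twist_chi_onto.
  have [u Ru <-] := f_onto k; exists (hol_act u 1 : regular_brace regularR).
  by rewrite /= /chi0 hol_act1K.
have Z1 m : 'Z([set: X m]) = 1.
  elim: m => [|m]; last exact: twist_center.
  exact: simple_centerless simS0 nonabS0.
have lamX m : lambda_simple (X m).
  elim: m => [|m]; last exact: twist_lambda_simple.
  exact: lambda_simple_of_simple simS0.
have powX m : is_power S (n.+2 ^ m) (X m).
  elim: m => [|m]; first by apply: (is_power1 (f := id)) => //; exists id.
  by rewrite expnS; exact: is_power_dirpow.
(* An element of character 1 is not the identity, whose character is 0. *)
have ntX m : [set: X m] != 1.
  have [x chix] := chi_onto m 1%R; apply/trivgPn; exists x; first by rewrite inE.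
  by apply: contraTneq (oner_neq0 'I_n.+2) => x1; rewrite -chix x1 chi1 eqxx.
exists (fun m => X m); split=> m.
  split; first exact: lambda_simple_simple.
    exact: is_power_isog.
  elim: m => [|m]; first exact: regular_brace_solvable.
  exact: twist_solvable.
(* The additive group of [X m.+1] is the direct power of that of [X m] by construction. Constant
   tuples are fixed by the shift, so on them the twisted product is coordinatewise. *)
exists id, id; split=> //.
  by move=> a b /ffunP/(_ ord0); rewrite !ffunE.
split=> a b; apply/ffunP=> i; first by rewrite !ffunE.
by rewrite twist_circE !ffunE.
Qed.
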